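(* $\mathrm{NICF}_4 + \mathrm{NICF}_4 \neq \mathbb{R}$, i.e., there is a real number $z$ that cannot be written as $z = x + y$ with $x, y \in \mathrm{NICF}_4$.
   Context: The nearest integer continued fraction (NICF) expansion $[a_0; a_1, a_2, \ldots]$ of a real number $x$ is obtained by setting $x_0 = x$ and iterating $a_i = \lfloor x_i \rceil$ (nearest integer) and $x_{i+1} = 1/(x_i - a_i)$ as long as $x_i \ne a_i$. For $r \ge 2$, $\mathrm{NICF}_r$ denotes the set of real numbers $x$ whose NICF expansion $[a_0;a_1,a_2,\ldots]$ satisfies $|a_i| \le r$ for all $i \ge 1$. *)

(* Defs.v *)
From Stdlib Require Import Reals ZArith.
Open Scope R_scope.

(* Ties are rounded up, so that x - nearest_int x lies in [-1/2, 1/2);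
   Stdlib's Int_part is the floor function on all of R. *)
Definition nearest_int (x : R) : Z := Int_part (x + 1 / 2).

(* The complete quotient x_i; None once the expansion has terminated. *)
Fixpoint nicf_quotient (x : R) (i : nat) : option R :=
  match i with
  | O => Some x
  | S j =>
      match nicf_quotient x j with
      | None => None
      | Some xj =>
          if Req_dec_T xj (IZR (nearest_int xj)) then None
          else Some (/ (xj - IZR (nearest_int xj)))
      end
  end.

Definition nicf_digit (x : R) (i : nat) : option Z :=
  option_map nearest_int (nicf_quotient x i).

(* The digit a_0 is unrestricted, and rationals (finite expansions) are allowed. *)
Definition NICF (r : Z) (x : R) : Prop :=
  forall (i : nat) (a : Z),
    (1 <= i)%nat -> nicf_digit x i = Some a -> (Z.abs a <= r)%Z.

(* Main.v *)
Require Import Defs.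
From Stdlib Require Import Reals ZArith.
From Stdlib Require Import List Bool Lra Lia.
Import ListNotations.
Open Scope R_scope.
Local Open Scope lazy_bool_scope.

(** Let F be the set of remainders x - a_0 with x in NICF_r. A nonzero element
    of F has the form 1/(a + u) with u in F and 2 <= |a| <= r, where u >= 0 if
    a = 2 and u <= 0 if a = -2. If x + y = p/q lies strictly between 0 and 1,
    then the remainders u, v of x and y satisfy q u + q v = p or
    q u + q v = p - q. Substituting u = 1/(a + u') in a relation
    A u v + B u + C v + D = 0 and clearing the denominator gives a relation of
    the same shape with integer coefficients. Such a form is affine in each
    variable, so it does not vanish on a rectangle if it has the same strict
    sign at the four corners. For r = 4 and p/q = 59/94, expanding u and v
    alternately, at most ten times in all, excludes every branch by this
    criterion. The fraction 59/94 was found by search: none with a smaller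
    denominator is excluded within twelve expansions. *)

Lemma nearest_int_bounds (x : R) :
  -1 / 2 <= x - IZR (nearest_int x) <= 1 / 2.
Proof.
  unfold nearest_int; destruct (base_Int_part (x + 1 / 2)); lra.
Qed.

Lemma nearest_int_ge (n : Z) (x : R) : IZR n <= x -> (n <= nearest_int x)%Z.
Proof.
  intros Hx; pose proof (nearest_int_bounds x).
  apply Z.lt_pred_le, lt_IZR; unfold Z.pred; rewrite plus_IZR; lra.
Qed.

Lemma nearest_int_le (n : Z) (x : R) : x <= IZR n -> (nearest_int x <= n)%Z.
Proof.
  intros Hx; pose proof (nearest_int_bounds x).
  apply Z.lt_succ_r, lt_IZR; rewrite succ_IZR; lra.
Qed.

Lemma nicf_quotient_inv_remainder (x : R) (i : nat) :
  x <> IZR (nearest_int x) ->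
  nicf_quotient (/ (x - IZR (nearest_int x))) i = nicf_quotient x (S i).
Proof.
  intros Hx; induction i as [|i IH].
  - simpl; destruct (Req_dec_T x (IZR (nearest_int x)));
      [contradiction|reflexivity].
  - cbn [nicf_quotient] in *; rewrite IH; reflexivity.
Qed.

Lemma NICF_inv_remainder (r : Z) (x : R) :
  NICF r x -> x <> IZR (nearest_int x) ->
  NICF r (/ (x - IZR (nearest_int x))) /\
  (Z.abs (nearest_int (/ (x - IZR (nearest_int x)))) <= r)%Z.
Proof.
  intros Hx Hne.
  pose proof (fun i => nicf_quotient_inv_remainder x i Hne) as Hq.
  split.
  - intros i a Hi Ha; apply (Hx (S i)); [lia|].
    unfold nicf_digit in *; rewrite <- Hq; exact Ha.
  - apply (Hx 1%nat); [lia|].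
    unfold nicf_digit; rewrite <- Hq; reflexivity.
Qed.

Definition nicf_remainder (r : Z) (s : R) : Prop :=
  exists x, NICF r x /\ s = x - IZR (nearest_int x).

Lemma nicf_remainder_bounds (r : Z) (s : R) :
  nicf_remainder r s -> -1 / 2 <= s <= 1 / 2.
Proof. intros [x [_ ->]]; apply nearest_int_bounds. Qed.

Lemma NICF_sum_remainders (r : Z) (x y z : R) :
  NICF r x -> NICF r y -> x + y = z -> 0 < z < 1 ->
  exists u v, nicf_remainder r u /\ nicf_remainder r v /\
    (u + v = z \/ u + v = z - 1).
Proof.
  intros Hx Hy Hz Bz.
  exists (x - IZR (nearest_int x)), (y - IZR (nearest_int y)).
  split; [exists x; auto|split; [exists y; auto|]].
  pose proof (nearest_int_bounds x).
  pose proof (nearest_int_bounds y).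
  pose proof (plus_IZR (nearest_int x) (nearest_int y)) as Hk.
  set (k := (nearest_int x + nearest_int y)%Z) in Hk.
  assert (-1 < k)%Z by (apply lt_IZR; lra).
  assert (k < 2)%Z by (apply lt_IZR; lra).
  assert (k = 0 \/ k = 1)%Z as [k0|k1] by lia.
  - left; rewrite k0 in Hk; lra.
  - right; rewrite k1 in Hk; lra.
Qed.

(* Endpoints are in units of 1/2. *)
Record interval := Interval { lower : Z; upper : Z }.

Definition in_interval (I : interval) (u : R) : Prop :=
  IZR (lower I) / 2 <= u <= IZR (upper I) / 2.

Definition zero_interval : interval := Interval 0 0.

Definition remainder_interval : interval := Interval (-1) 1.

(* A complete quotient with nearest integer 2 or -2 has absolute value at
   least 2, which halves the range of the remainder. *)
Definition interval_after (a : Z) : interval :=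
  if (a =? 2)%Z then Interval 0 1
  else if (a =? -2)%Z then Interval (-1) 0
  else remainder_interval.

Definition positive_digits (r : Z) : list Z :=
  map Z.of_nat (seq 2 (Z.to_nat r - 1)).

Definition digits (r : Z) (I : interval) : list Z :=
  (if (0 <? upper I)%Z then positive_digits r else []) ++
  (if (lower I <? 0)%Z then map Z.opp (positive_digits r) else []).

Lemma in_remainder_interval (r : Z) (u : R) :
  nicf_remainder r u -> in_interval remainder_interval u.
Proof.
  intros Hu; apply nicf_remainder_bounds in Hu; split; simpl; lra.
Qed.

Lemma inv_half_bounds (s : R) :
  -1 / 2 <= s <= 1 / 2 -> s <> 0 ->
  s < 0 /\ / s <= -2 \/ 0 < s /\ 2 <= / s.
Proof.
  intros Bs Hs; pose proof (Rinv_r s Hs).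
  destruct (Rtotal_order s 0) as [Neg|[Zero|Pos]];
    [left|contradiction|right]; (split; [assumption|nra]).
Qed.

Lemma in_interval_after (y : R) :
  y <= -2 \/ 2 <= y ->
  in_interval (interval_after (nearest_int y)) (y - IZR (nearest_int y)).
Proof.
  intros Hy; pose proof (nearest_int_bounds y).
  unfold interval_after, in_interval.
  destruct (Z.eqb_spec (nearest_int y) 2) as [E|_];
    [|destruct (Z.eqb_spec (nearest_int y) (-2)) as [E|_]];
    try rewrite E in *; simpl; destruct Hy; lra.
Qed.

Lemma in_positive_digits (r a : Z) :
  (2 <= a <= r)%Z -> In a (positive_digits r).
Proof.
  intros Ha; apply in_map_iff; exists (Z.to_nat a).
  split; [lia|apply in_seq; lia].
Qed.

Lemma nearest_int_inv_in_digits (r : Z) (I : interval) (s : R) :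
  in_interval I s -> -1 / 2 <= s <= 1 / 2 -> s <> 0 ->
  (Z.abs (nearest_int (/ s)) <= r)%Z -> In (nearest_int (/ s)) (digits r I).
Proof.
  intros [Hl Hu] Bs Hs Ha; unfold digits; apply in_or_app.
  destruct (inv_half_bounds s Bs Hs) as [[Neg Hinv]|[Pos Hinv]]; [right|left].
  - apply (nearest_int_le (-2)) in Hinv.
    assert (Hlower : (lower I < 0)%Z) by (apply lt_IZR; lra).
    apply Z.ltb_lt in Hlower as ->.
    apply in_map_iff; exists (- nearest_int (/ s))%Z.
    split; [lia|apply in_positive_digits; lia].
  - apply (nearest_int_ge 2) in Hinv.
    assert (Hupper : (0 < upper I)%Z) by (apply lt_IZR; lra).
    apply Z.ltb_lt in Hupper as ->.
    apply in_positive_digits; lia.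
Qed.

Lemma nicf_remainder_expand (r : Z) (I : interval) (s : R) :
  nicf_remainder r s -> in_interval I s -> s <> 0 ->
  exists (a : Z) (u : R),
    In a (digits r I) /\ nicf_remainder r u /\
    in_interval (interval_after a) u /\ s * (IZR a + u) = 1.
Proof.
  intros Hr HI Hs.
  pose proof (nicf_remainder_bounds r s Hr) as Bs.
  destruct Hr as [x [Hx Es]].
  destruct (NICF_inv_remainder r x Hx) as [Hinv Hdigit]; [lra|].
  rewrite <- Es in Hinv, Hdigit.
  exists (nearest_int (/ s)), (/ s - IZR (nearest_int (/ s))).
  split; [|split; [|split]].
  - apply nearest_int_inv_in_digits; assumption.
  - exists (/ s); auto.
  - apply in_interval_after; pose proof (inv_half_bounds s Bs Hs); tauto.
  - transitivity (s * / s); [ring|apply Rinv_r; exact Hs].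
Qed.

Record biaffine := Biaffine {
  coef_uv : Z;
  coef_u : Z;
  coef_v : Z;
  coef_1 : Z
}.

Definition eval (f : biaffine) (u v : R) : R :=
  IZR (coef_uv f) * u * v + IZR (coef_u f) * u + IZR (coef_v f) * v
  + IZR (coef_1 f).

Definition opp (f : biaffine) : biaffine :=
  Biaffine (- coef_uv f) (- coef_u f) (- coef_v f) (- coef_1 f).

(* The numerator of f (1 / (a + w)) v, with the two variables exchanged so
   that the next expansion acts on v; [at_zero] exchanges them too. *)
Definition expand (a : Z) (f : biaffine) : biaffine :=
  Biaffine (coef_v f) (coef_uv f + a * coef_v f)
           (coef_1 f) (coef_u f + a * coef_1 f).

Definition at_zero (f : biaffine) : biaffine :=
  Biaffine 0 (coef_v f) 0 (coef_1 f).

Lemma eval_opp (f : biaffine) (u v : R) : eval (opp f) u v = - eval f u v.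
Proof. unfold eval; simpl; rewrite !opp_IZR; ring. Qed.

Lemma eval_expand (a : Z) (f : biaffine) (u v w : R) :
  u * (IZR a + w) = 1 -> eval (expand a f) v w = (IZR a + w) * eval f u v.
Proof.
  intros Hu; unfold eval; simpl; rewrite !plus_IZR, !mult_IZR.
  transitivity
    ((IZR (coef_uv f) * v + IZR (coef_u f)) * (u * (IZR a + w))
     + (IZR a + w) * (IZR (coef_v f) * v + IZR (coef_1 f)));
    [rewrite Hu|]; ring.
Qed.

Lemma eval_at_zero (f : biaffine) (v w : R) :
  eval (at_zero f) v w = eval f 0 v.
Proof. unfold eval; simpl; ring. Qed.

Lemma affine_positive (p q l h t : R) :
  l <= t <= h -> 0 < p * l + q -> 0 < p * h + q -> 0 < p * t + q.
Proof. intros; destruct (Rle_or_lt 0 p); nra. Qed.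

Lemma eval_positive (f : biaffine) (l h l' h' u v : R) :
  l <= u <= h -> l' <= v <= h' ->
  0 < eval f l l' -> 0 < eval f l h' -> 0 < eval f h l' -> 0 < eval f h h' ->
  0 < eval f u v.
Proof.
  intros Hu Hv Hll Hlh Hhl Hhh.
  assert (affine_v : forall s t, eval f s t =
    (IZR (coef_uv f) * s + IZR (coef_v f)) * t
    + (IZR (coef_u f) * s + IZR (coef_1 f))) by (intros; unfold eval; ring).
  assert (affine_u : forall s t, eval f s t =
    (IZR (coef_uv f) * t + IZR (coef_u f)) * s
    + (IZR (coef_v f) * t + IZR (coef_1 f))) by (intros; unfold eval; ring).
  assert (edge_l : 0 < eval f l v)
    by (rewrite affine_v in *; exact (affine_positive _ _ _ _ _ Hv Hll Hlh)).
  assert (edge_h : 0 < eval f h v)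
    by (rewrite affine_v in *; exact (affine_positive _ _ _ _ _ Hv Hhl Hhh)).
  rewrite affine_u in *; exact (affine_positive _ _ _ _ _ Hu edge_l edge_h).
Qed.

(* The factor 4 clears the denominators of the half-integer arguments. *)
Definition corner (f : biaffine) (i j : Z) : Z :=
  (coef_uv f * i * j + 2 * coef_u f * i + 2 * coef_v f * j + 4 * coef_1 f)%Z.

Definition corners_positive (f : biaffine) (I J : interval) : bool :=
  forallb (fun i => forallb (fun j => 0 <? corner f i j)%Z [lower J; upper J])
    [lower I; upper I].

Lemma IZR_corner (f : biaffine) (i j : Z) :
  IZR (corner f i j) = 4 * eval f (IZR i / 2) (IZR j / 2).
Proof.
  unfold corner, eval; rewrite !plus_IZR, !mult_IZR; field.
Qed.

Lemma corners_positive_sound (f : biaffine) (I J : interval) (u v : R) :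
  corners_positive f I J = true -> in_interval I u -> in_interval J v ->
  0 < eval f u v.
Proof.
  intros Hpos Hu Hv; unfold corners_positive in Hpos.
  assert (corner_positive : forall i j,
    In i [lower I; upper I] -> In j [lower J; upper J] ->
    0 < eval f (IZR i / 2) (IZR j / 2)).
  { intros i j Hi Hj; rewrite forallb_forall in Hpos.
    specialize (Hpos i Hi); rewrite forallb_forall in Hpos.
    specialize (Hpos j Hj); apply Z.ltb_lt, IZR_lt in Hpos.
    rewrite IZR_corner in Hpos; lra. }
  apply (eval_positive f _ _ _ _ u v Hu Hv); apply corner_positive; simpl; auto.
Qed.

Definition definite (f : biaffine) (I J : interval) : bool :=
  corners_positive f I J || corners_positive (opp f) I J.

Lemma definite_sound (f : biaffine) (I J : interval) (u v : R) :
  definite f I J = true -> in_interval I u -> in_interval J v ->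
  eval f u v <> 0.
Proof.
  intros Hdef Hu Hv; apply orb_prop in Hdef as [Hpos|Hneg].
  - pose proof (corners_positive_sound f I J u v Hpos Hu Hv); lra.
  - pose proof (corners_positive_sound (opp f) I J u v Hneg Hu Hv) as Hopp.
    rewrite eval_opp in Hopp; lra.
Qed.

(* The lazy disjunction keeps call-by-value evaluation from expanding branches
   that are already excluded. *)
Fixpoint nonvanishing (r : Z) (n : nat) (f : biaffine) (I J : interval)
    : bool :=
  definite f I J |||
  match n with
  | O => false
  | S m =>
      nonvanishing r m (at_zero f) J zero_interval &&
      forallb (fun a => nonvanishing r m (expand a f) J (interval_after a))
        (digits r I)
  end.

Lemma nonvanishing_sound (r : Z) (n : nat) (f : biaffine) (I J : interval)
    (u v : R) :
  nonvanishing r n f I J = true ->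
  nicf_remainder r u -> nicf_remainder r v ->
  in_interval I u -> in_interval J v ->
  eval f u v <> 0.
Proof.
  revert f I J u v; induction n as [|n IH];
    intros f I J u v Hcheck Ru Rv Iu Jv; cbn [nonvanishing] in Hcheck;
    rewrite <- orb_lazy_alt in Hcheck;
    apply orb_prop in Hcheck as [Hdef|Hcheck];
    try (exact (definite_sound f I J u v Hdef Iu Jv)).
  - discriminate.
  - apply andb_prop in Hcheck as [Hzero Hdigits].
    rewrite forallb_forall in Hdigits.
    destruct (Req_dec_T u 0) as [->|u_neq0].
    + rewrite <- (eval_at_zero f v 0).
      apply (IH _ _ _ v 0 Hzero); trivial.
      split; simpl; lra.
    + destruct (nicf_remainder_expand r I u Ru Iu u_neq0)
        as (a & w & a_digit & Rw & Iw & Euw).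
      intros E; apply (IH _ _ _ v w (Hdigits a a_digit)); trivial.
      rewrite (eval_expand a f u v w Euw), E; ring.
Qed.

Definition sum_form (q d : Z) : biaffine := Biaffine 0 q q d.

Lemma eval_sum_form (q d : Z) (u v : R) :
  eval (sum_form q d) u v = IZR q * (u + v) + IZR d.
Proof. unfold eval; simpl; ring. Qed.

Lemma NICF_sum_neq (r : Z) (n : nat) (p q : Z) :
  (0 < p < q)%Z ->
  nonvanishing r n (sum_form q (- p))
    remainder_interval remainder_interval = true ->
  nonvanishing r n (sum_form q (q - p))
    remainder_interval remainder_interval = true ->
  forall x y : R, NICF r x -> NICF r y -> x + y <> IZR p / IZR q.
Proof.
  intros [Hp Hpq] check_p check_qp x y Hx Hy E.
  apply IZR_lt in Hp, Hpq.
  assert (Hz : 0 < IZR p / IZR q < 1).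
  { split; [apply Rdiv_lt_0_compat; lra|].
    apply Rmult_lt_reg_r with (IZR q); [lra|].
    field_simplify; lra. }
  destruct (NICF_sum_remainders r x y _ Hx Hy E Hz)
    as (u & v & Ru & Rv & Huv).
  pose proof (in_remainder_interval r u Ru) as Iu.
  pose proof (in_remainder_interval r v Rv) as Iv.
  destruct Huv as [Huv|Huv].
  - apply (nonvanishing_sound _ _ _ _ _ u v check_p Ru Rv Iu Iv).
    rewrite eval_sum_form, Huv, opp_IZR; field; lra.
  - apply (nonvanishing_sound _ _ _ _ _ u v check_qp Ru Rv Iu Iv).
    rewrite eval_sum_form, Huv, minus_IZR; field; lra.
Qed.

Theorem theorem6p3 :
  exists z : R, ~ exists x y : R, NICF 4 x /\ NICF 4 y /\ z = x + y.
Proof.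
  exists (59 / 94); intros (x & y & Hx & Hy & E).
  refine (NICF_sum_neq 4 10 59 94 _ _ _ x y Hx Hy (eq_sym E)).
  - lia.
  - vm_compute; reflexivity.
  - vm_compute; reflexivity.
Qed.
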